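(* A finitely generated torsion-free ring of polynomial growth is virtually nilpotent. More precisely, for every real $d>0$ there is a constant $C(d)$ depending only on $d$ such that: if $S$ is a torsion-free ring generated by a finite additively symmetric set $X$ for which $|X^{\leq n}|\leq n^d|X|$ for arbitrarily large positive integers $n$, then $S$ has an ideal of index at most $C(d)$ which is nilpotent of class at most $4(57d+1)$. In particular, $S$ is virtually nilpotent.
   Context: Rings are associative but not necessarily commutative or unital; ideals are two-sided, and index means additive index. Torsion-free means that the additive group is torsion-free. Additively symmetric means $0\in X$ and $X=-X$. For a subset $X$ of a ring, $X^{\leq n}$ denotes the set of elements obtained from $X$ using $+$ and $\cdot$ in such a way that elements of $X$ are used at most $n$ times (counting repetitions). A ring generated by a finite additively symmetric set $X$ has polynomial growth if there are $d\in\mathbb{N}$ and a constant $C$ with $|X^{\leq n}|\leq Cn^d$ for all positive integers $n$ (this does not depend on the choice of the finite generating set). A ring is nilpotent of class at most $c$ if every product of more than $c$ of its elements is $0$. A ring is virtually nilpotent if it has a nilpotent ideal of finite index (equivalently, a nilpotent subring of finite index). *)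

(* Defs.v *)
From HB Require Import structures.
From mathcomp Require Import all_boot all_order all_algebra.
From mathcomp Require Import finmap.
From mathcomp Require Import all_classical all_reals all_analysis.

Set Implicit Arguments.
Unset Strict Implicit.
Unset Printing Implicit Defensive.

Import Order.TTheory GRing.Theory Num.Theory.

Local Open Scope classical_set_scope.
Local Open Scope ring_scope.

(* MathComp's ring structures are all unital; rngType is the structure of
   associative rings, not necessarily commutative or unital. *)
HB.mixin Record Zmodule_isRng S of GRing.Zmodule S := {
  rmul : S -> S -> S;
  rmulA : associative rmul;
  rmulDl : left_distributive rmul +%R;
  rmulDr : right_distributive rmul +%R
}.

#[short(type="rngType")]
HB.structure Definition Rng := { S of Zmodule_isRng S & GRing.Zmodule S }.

Notation "x ** y" := (rmul x y) (at level 40, left associativity) : ring_scope.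

Section Rings.
Variable S : rngType.
Implicit Types (X I : set S).

Definition torsion_free : Prop :=
  forall (n : nat) (x : S), (0 < n)%N -> x *+ n = 0 -> x = 0.

Definition additively_symmetric X : Prop := X 0 /\ -%R @` X = X.

Definition additive_subgroup X : Prop :=
  X 0 /\ (forall x y, X x -> X y -> X (x - y)).

Definition subring X : Prop :=
  additive_subgroup X /\ (forall x y, X x -> X y -> X (x ** y)).

Definition ideal I : Prop :=
  additive_subgroup I /\ (forall s x, I x -> I (s ** x) /\ I (x ** s)).

Definition generated_by X : Prop := smallest subring X = [set: S].

Definition finitely_generated : Prop :=
  exists X, finite_set X /\ generated_by X.

(* [obtained X m a]: a is the value of an expression built from elements of X
   with + and the product, with exactly m leaves. *)
Inductive obtained X : nat -> S -> Prop :=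
| obtained_gen x : X x -> obtained X 1 x
| obtained_add m n a b :
    obtained X m a -> obtained X n b -> obtained X (m + n) (a + b)
| obtained_mul m n a b :
    obtained X m a -> obtained X n b -> obtained X (m + n) (a ** b).

(* X^{<= n} *)
Definition upto X (n : nat) : set S :=
  [set a | exists2 m, (m <= n)%N & obtained X m a].

(* fset_set is a junk value on infinite sets; upto X n is not one of them. *)
Lemma finite_upto X n : finite_set X -> finite_set (upto X n).
Proof.
have pos m a : obtained X m a -> (0 < m)%N.
  by elim=> // {}m n' {}a b _ m0 _ _; rewrite addn_gt0 m0.
move=> finX; elim: n => [|n IHn].
  apply: (sub_finite_set (B := set0)) => // a [m].
  by rewrite leqn0 => /eqP -> /pos.
apply: (sub_finite_set (B := X `|`
    ([set a + b | a in upto X n & b in upto X n] `|`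
     [set a ** b | a in upto X n & b in upto X n]))).
  have split2 p q : (0 < p)%N -> (0 < q)%N -> (p + q <= n.+1)%N ->
      (p <= n)%N /\ (q <= n)%N.
    move=> p0 q0 pq; split; rewrite -ltnS; apply: leq_trans pq.
      by rewrite -[X in (X < _)%N]addn0 ltn_add2l.
    by rewrite -[X in (X < _)%N]add0n ltn_add2r.
  move=> y [m + obt]; case: obt => [x Xx|p q a b pa qb|p q a b pa qb]; first by left.
  - move=> /(split2 _ _ (pos _ _ pa) (pos _ _ qb))[pn qn]; right; left.
    by exists a; [exists p | exists b => //; exists q].
  - move=> /(split2 _ _ (pos _ _ pa) (pos _ _ qb))[pn qn]; right; right.
    by exists a; [exists p | exists b => //; exists q].
by rewrite !finite_setU; split=> //; split; exact: finite_image2.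
Qed.

Definition polynomial_growth (R : realType) : Prop :=
  exists X, [/\ finite_set X, additively_symmetric X, generated_by X &
    exists (d : nat) (C : R), forall n, (0 < n)%N ->
      #|` fset_set (upto X n)|%:R <= C * n%:R ^+ d].

Definition cosets I : set (set S) := range (fun a => [set a + b | b in I]).

Definition finite_index I : Prop := finite_set (cosets I).

(* Meaningful only when I has finite index. *)
Definition additive_index I : nat := #|` fset_set (cosets I)|.

(* c need not be an integer: any product of more than c elements of I is 0. *)
Definition nilpotent_of_class_le (R : numDomainType) (c : R) I : Prop :=
  forall (x : S) (s : seq S), c < (size (x :: s))%:R ->
    [set` x :: s] `<=` I -> foldl rmul x s = 0.

Definition nilpotent I : Prop :=
  exists c : nat, nilpotent_of_class_le (c%:Z) I.

Definition virtually_nilpotent : Prop :=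
  exists I, [/\ ideal I, finite_index I & nilpotent I].

End Rings.

Arguments torsion_free S : clear implicits.
Arguments finitely_generated S : clear implicits.
Arguments polynomial_growth S R : clear implicits.
Arguments virtually_nilpotent S : clear implicits.

(* Main.v *)
(** A torsion-free ring S satisfying the growth hypothesis is itself nilpotent
    of class at most d, so that I = S works, with index 1.
    - If v_1, ..., v_k in S are linearly independent over Z, their combinations
      with coefficients in {1, ..., q} give q^k elements of X^{<= O(q)}; hence
      k <= d.
    - No nonzero u satisfies u w = a u with w in S and a a nonzero integer:
      doubling w makes a even, and then the 2^q elements
      (...((u w + c_1 u) w + c_2 u) ...) w + c_q u with c_i in {0, 1} are
      distinct elements of X^{<= O(q)}.
    - If x_0 x_1 ... x_m <> 0 with m + 1 > d, the m + 1 nonzero partial products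
      u_i = x_0 ... x_i are linearly dependent.  In a relation
      \sum_i c_i u_i = 0 let i be least with c_i <> 0: every u_j with j > i is a
      right multiple of u_i, so c_i u_i = u_i w for some w, a contradiction. *)
Require Import Defs.
From HB Require Import structures.
From mathcomp Require Import all_boot all_order all_algebra.
From mathcomp Require Import finmap.
From mathcomp Require Import all_classical all_reals all_analysis.
From mathcomp Require Import zify ring lra.
Set Implicit Arguments.
Unset Strict Implicit.
Import Order.TTheory GRing.Theory Num.Theory.
Local Open Scope classical_set_scope.
Local Open Scope ring_scope.

(** * Products and integer multiples in associative rings *)

Section RngTheory.
Context {S : rngType}.
Implicit Types (x y u w : S) (X : set S).

Lemma rmul_is_zmod_morphism x : zmod_morphism (rmul x).
Proof.
move=> y z; apply: (addIr (x ** z)).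
by rewrite -rmulDr !subrK.
Qed.

HB.instance Definition _ x :=
  GRing.isZmodMorphism.Build S S (rmul x) (rmul_is_zmod_morphism x).

Lemma rmulrMz x y (c : int) : x ** (y *~ c) = (x ** y) *~ c.
Proof. exact: (raddfMz (rmul x)). Qed.

Lemma rmulBl x y z : (x - y) ** z = x ** z - y ** z.
Proof.
apply: (addIr (y ** z)).
by rewrite -rmulDl !subrK.
Qed.

Lemma rmul0l x : 0 ** x = 0.
Proof. by rewrite -{1}(subrr 0) rmulBl subrr. Qed.

Lemma rmulNl x y : (- x) ** y = - (x ** y).
Proof. by rewrite -(sub0r x) rmulBl rmul0l sub0r. Qed.

Lemma rmulMzl x y (c : int) : (x *~ c) ** y = (x ** y) *~ c.
Proof.
have nat_case (n : nat) : (x *+ n) ** y = (x ** y) *+ n.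
  by elim: n => [|n IHn]; rewrite ?mulr0n ?rmul0l // !mulrS rmulDl IHn.
by case: c => n; rewrite ?NegzE ?mulrNz -?pmulrn ?rmulNl nat_case.
Qed.

Lemma foldl_rmul0 (s : seq S) : foldl rmul 0 s = 0.
Proof. by elim: s => //= y s; rewrite rmul0l. Qed.

(** Associativity pulls the first factor out of a left-nested product; this exhibits later partial
    products as right multiples of earlier ones. *)
Lemma foldl_rmulA x y (s : seq S) :
  foldl rmul (x ** y) s = x ** foldl rmul y s.
Proof. by elim: s y => //= z s IHs y; rewrite -rmulA IHs. Qed.

Lemma torsion_free_mulrz_eq0 u (c : int) :
  torsion_free S -> u != 0 -> u *~ c = 0 -> c = 0.
Proof.
move=> tfS u0; case: c => n.
  rewrite -pmulrn; case: n => // n /tfS u_eq0.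
  by rewrite u_eq0 ?eqxx in u0.
rewrite NegzE mulrNz -pmulrn => /eqP; rewrite oppr_eq0 => /eqP /tfS u_eq0.
by rewrite u_eq0 ?eqxx in u0.
Qed.

(** * The whole ring as an ideal of index 1 *)

Lemma ideal_setT : ideal [set: S]. Proof. by []. Qed.

Lemma cosets_setT : cosets [set: S] = [set setT].
Proof.
have cosetT a : [set a + b | b in [set: S]] = setT.
  by apply/seteqP; split=> // y _; exists (y - a) => //; rewrite addrC subrK.
by apply/seteqP; split=> [_ [a _ <-]|_ ->] /=; [|exists 0]; rewrite ?cosetT.
Qed.

Lemma finite_index_setT : finite_index [set: S].
Proof. by rewrite /finite_index cosets_setT; exact: finite_set1. Qed.

Lemma additive_index_setT : additive_index [set: S] = 1%N.
Proof. by rewrite /additive_index cosets_setT fset_set1 cardfs1. Qed.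

(** * Expressions in [X], the sets X^{<= n} and their cardinalities *)

Lemma obtained_opp X n x :
  additively_symmetric X -> obtained X n x -> obtained X n (- x).
Proof.
move=> [_ symX]; elim=> {n x} [x Xx|m n a b _ IHa _ IHb|m n a b _ IHa obb _].
- by apply: obtained_gen; rewrite -symX; exists x.
- by rewrite opprD; apply: obtained_add.
(* Only the left factor of a product takes the sign. *)
- by rewrite -rmulNl; apply: obtained_mul.
Qed.

(** The values of expressions form a subring containing [X]; closure under subtraction comes from
    [obtained_opp]. *)
Lemma generated_obtained X : additively_symmetric X -> generated_by X ->
  forall x, exists n, obtained X n x.
Proof.
move=> symX genX x.
have : smallest (@subring _) X x by rewrite genX.
move=> /(_ [set y | exists n, obtained X n y]); apply; split; last first.
  by move=> y Xy; exists 1%N; exact: obtained_gen.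
split; [split|].
- by exists 1%N; apply: obtained_gen; case: symX.
- move=> y z [m obm] [n obn]; exists (m + n)%N.
  exact/obtained_add/obtained_opp.
- by move=> y z [m obm] [n obn]; exists (m + n)%N; exact: obtained_mul.
Qed.

Lemma le_upto X m n : (m <= n)%N -> upto X m `<=` upto X n.
Proof. by move=> mn x [p pm obx]; exists p => //; exact: leq_trans mn. Qed.

Lemma uptoD X m n x y : upto X m x -> upto X n y -> upto X (m + n) (x + y).
Proof.
move=> [p pm obx] [q qn oby].
by exists (p + q)%N; [exact: leq_add|exact: obtained_add].
Qed.

Lemma uptoM X m n x y : upto X m x -> upto X n y -> upto X (m + n) (x ** y).
Proof.
move=> [p pm obx] [q qn oby].
by exists (p + q)%N; [exact: leq_add|exact: obtained_mul].
Qed.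

Lemma upto_mulrSn X m x j : upto X m x -> upto X (m * j.+1) (x *+ j.+1).
Proof.
move=> Xx; elim: j => [|j IHj]; first by rewrite muln1 mulr1n.
by rewrite mulnS mulrS; exact: uptoD.
Qed.

(** The empty sum 0 takes a leaf too, hence one block of [m] beyond those of the summands. *)
Lemma upto_sum X m (I : Type) (s : seq I) (F : I -> S) :
  upto X m 0 -> (forall i, upto X m (F i)) ->
  upto X (m * (size s).+1) (\sum_(i <- s) F i).
Proof.
move=> X0 XF; elim: s => [|i s IHs]; first by rewrite big_nil muln1.
by rewrite big_cons /= mulnS; exact: uptoD.
Qed.

Lemma leq_card_upto X n (T : finType) (f : T -> S) :
  finite_set X -> injective f -> (forall t, upto X n (f t)) ->
  (#|T| <= #|` fset_set (upto X n)|)%N.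
Proof.
move=> finX injf Xf; rewrite cardE -(size_map f); apply: uniq_leq_size.
  by rewrite map_inj_uniq ?enum_uniq.
move=> _ /mapP [t _ ->]; rewrite in_fset_set; last exact: finite_upto.
by rewrite inE.
Qed.

End RngTheory.

(** * Consequences of polynomial growth *)

Section Growth.
Context {R : realType} {S : rngType}.
Variables (X : set S) (d K : R).
Hypotheses (tfS : torsion_free S) (finX : finite_set X).
Hypotheses (symX : additively_symmetric X) (genX : generated_by X).
(** The factor [K] covers both uses: it is the size of [X] in the quantitative statement and the
    constant of polynomial growth in the qualitative one. *)
Hypothesis growthX : forall N : nat, exists n : nat, [/\ (N <= n)%N, (0 < n)%N &
  #|` fset_set (upto X n)|%:R <= n%:R `^ d * K].

Let generated_upto (x : S) : exists n, upto X n.+1 x.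
Proof.
have [n obx] := generated_obtained symX genX x.
by exists n, n.
Qed.

Let upto0 n : upto X n.+1 0.
Proof. by exists 1%N => //; apply: obtained_gen; case: symX. Qed.

(** With [q] the integer part of n / L, the two bounds on X^{<= n} would give n^(e - d) <= (2L)^e K,
    which fails for large [n]. *)
Lemma growth_exponent_bound (e L : nat) : d < e%:R -> (0 < L)%N ->
  ~ (forall q, (0 < q)%N -> (q ^ e <= #|` fset_set (upto X (L * q))|)%N).
Proof.
move=> de L0 lowX.
pose M : R := `|(2 * L)%:R ^+ e * K| + 1.
have M0 : 0 < M by rewrite ltr_wpDl.
(* Once [n] is at least [y], n^(e - d) is at least [M], which exceeds (2L)^e K. *)
pose y := M `^ (e%:R - d)^-1.
have [n [nN n0 nX]] := growthX (maxn L (Num.bound y)).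
have Ln : (L <= n)%N by apply: leq_trans nN; exact: leq_maxl.
have yn : y <= n%:R.
  apply: le_trans (ltW (archi_boundP (powR_ge0 _ _))) _.
  by rewrite ler_nat (leq_trans _ nN) ?leq_maxr.
pose q := (n %/ L)%N.
have q0 : (0 < q)%N by rewrite divn_gt0.
(* As [q] is positive, n < L(q + 1) <= 2Lq. *)
have nq : (n <= 2 * L * q)%N by have := ltn_ceil n L0; rewrite -/q; nia.
have qX : q%:R ^+ e <= n%:R `^ d * K :> R.
  apply: le_trans nX; rewrite -natrX ler_nat; apply: leq_trans (lowX _ q0) _.
  rewrite fsubset_leq_card // -fset_set_sub; do ?exact: finite_upto.
  by apply: le_upto; rewrite mulnC leq_divM.
have n0R : 0 < n%:R :> R by rewrite ltr0n.
have neX : n%:R ^+ e <= (2 * L)%:R ^+ e * K * n%:R `^ d :> R.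
  apply: (@le_trans _ _ ((2 * L)%:R ^+ e * q%:R ^+ e)).
    by rewrite -exprMn -natrM lerXn2r ?nnegrE // ler_nat.
  by rewrite -mulrA [K * _]mulrC ler_wpM2l ?exprn_ge0.
have Mn : M <= n%:R `^ (e%:R - d).
  have -> : M = y `^ (e%:R - d).
    by rewrite -powRrM mulVf ?powRr1 ?(ltW M0) // subr_eq0 gt_eqF.
  by rewrite ge0_ler_powR ?nnegrE ?subr_ge0 ?(ltW de) ?powR_ge0.
have : n%:R ^+ e < M * n%:R `^ d :> R.
  apply: le_lt_trans neX _; rewrite ltr_pM2r ?powR_gt0 //.
  by rewrite (le_lt_trans (ler_norm _)) // ltrDl.
apply/negP; rewrite -leNgt -powR_mulrn ?(ltW n0R) //.
rewrite -[in leRHS](subrK d e%:R) powRD; last by rewrite (gt_eqF n0R) implybT.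
by rewrite ler_pM2r ?powR_gt0.
Qed.

Lemma linearly_dependent (k : nat) (v : 'I_k -> S) : d < k%:R ->
  exists2 c : 'I_k -> int, \sum_i v i *~ c i = 0 & exists i, c i != 0.
Proof.
move=> dk; apply: contrapT => dep.
have indep (c : 'I_k -> int) : \sum_i v i *~ c i = 0 -> forall i, c i = 0.
  move=> sum0 i; apply/eqP; apply: contrapT => /negP ci.
  by apply: dep; exists c => //; exists i.
have [m Xm] : exists m, forall i, upto X m.+1 (v i).
  have [m Xm] := choice (fun i => generated_upto (v i)).
  exists (\max_i m i)%N => i; apply: le_upto (Xm i).
  by rewrite ltnS; exact: leq_bigmax.
(* Each of the [k] summands costs at most [m.+1] leaves times the largest coefficient; the extra
   block in [k.+1] pays for the final 0 of the sum. *)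
apply: (@growth_exponent_bound k (m.+1 * k.+1)) => // -[//|q] _.
pose f (c : {ffun 'I_k -> 'I_q.+1}) := \sum_i v i *+ (c i).+1.
have -> : (q.+1 ^ k = #|{ffun 'I_k -> 'I_q.+1}|)%N
  by rewrite card_ffun !card_ord.
apply: (@leq_card_upto _ _ _ _ f) => // [c c' /eqP|c].
  rewrite -subr_eq0 -sumrB => /eqP sum0; apply/ffunP => i; apply/val_inj.
  have /indep/(_ i) : \sum_i v i *~ ((c i).+1%:Z - (c' i).+1%:Z) = 0.
    by rewrite -[RHS]sum0; apply: eq_bigr => j _; rewrite mulrzBr.
  by move=> /= ?; lia.
have := @upto_sum _ X (m.+1 * q.+1) _ (index_enum 'I_k)
  (fun i => v i *+ (c i).+1).
have -> : size (index_enum 'I_k) = k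
  by rewrite [index_enum _]unlock -enumT size_enum_ord.
rewrite mulnAC; apply=> [|i].
  by rewrite mulSn; exact: upto0.
apply: le_upto (upto_mulrSn (c i) (Xm i)).
by rewrite leq_pmul2l.
Qed.

Lemma no_right_eigenvector (u w : S) (a : int) :
  u != 0 -> a != 0 -> u ** w <> u *~ a.
Proof.
move=> u0 a0 uw.
have [p Xu] := generated_upto u.
have [r Xw] := generated_upto (w + w).
(* Horner's scheme: since u (w + w) = 2a u, a word of bits becomes [u] times an integer written in
   base 2a, each bit costing boundedly many leaves. *)
pose h := foldr (fun (b : bool) x => x ** (w + w) + (if b then u else 0)) u.
pose z := foldr (fun (b : bool) (x : int) => 2 * a * x + b) 1.
have hE s : h s = u *~ z s.
  elim: s => [|b s IHs] /=; first by rewrite mulr1z.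
  rewrite {}IHs rmulMzl rmulDr uw -mulrzDr -mulrzA mulrzDr.
  by congr (_ *~ _ + _); [ring|case: b].
(* The base 2a is even, so parity reveals the first bit; cancelling the nonzero 2a then leaves the
   remaining word. *)
have z_inj s t : size s = size t -> z s = z t -> s = t.
  elim: s t => [|b s IHs] [|b' t] //= [st] zz.
  have -> : b = b' by case: b b' zz => -[] /= zz //; lia.
  congr (_ :: _); apply: IHs => //; apply: (@mulfI _ (2 * a)).
    by rewrite mulf_neq0.
  by have {}zz := zz; case: b b' zz => -[] /= zz //; lia.
have Xh s : upto X ((p.+1 + r.+1) * (size s).+1) (h s).
  elim: s => [|b s IHs]; first by apply: le_upto Xu; lia.
  have Xb : upto X p.+1 (if b then u else 0) by case: b.
  by apply: le_upto (uptoD (uptoM IHs Xw) Xb); rewrite /=; lia.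
(* A natural number above [d]. Words of length [q * e] give 2^(qe) >= q^e elements at a cost linear
   in [q]. *)
pose e := Num.bound `|d|.
apply: (@growth_exponent_bound e ((p.+1 + r.+1) * e.+1)) => // [|q q0].
  exact: le_lt_trans (ler_norm _) (archi_boundP (normr_ge0 d)).
apply: (@leq_trans (2 ^ (q * e))%N).
  by rewrite expnM; case: (e) => // e'; rewrite leq_exp2r // ltnW // ltn_expl.
have <- : #|{: (q * e).-tuple bool}| = (2 ^ (q * e))%N
  by rewrite card_tuple card_bool.
apply: (@leq_card_upto _ _ _ _
  (fun t : (q * e).-tuple bool => h t)) => // [s t|t].
  rewrite !hE => /eqP; rewrite -subr_eq0 -mulrzBr => /eqP.
  move=> /(torsion_free_mulrz_eq0 tfS u0) /eqP; rewrite subr_eq0 => /eqP zz.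
  by apply/val_inj/z_inj; rewrite ?size_tuple.
apply: le_upto (Xh t); rewrite size_tuple -mulnA leq_pmul2l //; nia.
Qed.

Lemma nilpotent_setT : nilpotent_of_class_le d [set: S].
Proof.
move=> x s dk _; apply/eqP; apply: contrapT => /negP us0.
pose v (i : 'I_(size s).+1) := foldl rmul x (take i s).
have v0 i : v i != 0.
  apply: contraNneq us0 => vi0.
  rewrite -(cat_take_drop i s) foldl_cat.
  by rewrite [foldl _ _ (take i s)]vi0 foldl_rmul0.
have [c sum0 [i0 ci0]] := linearly_dependent v dk.
case: (@arg_minnP _ i0 (fun i => c i != 0) val ci0) => i ci imin.
(* Terms before [i] vanish by minimality of [i]; each later [v j] is a right multiple of [v i]. *)
have [w vw] : exists w, \sum_(j | j != i) v j *~ c j = v i ** w.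
  elim/big_ind: _ => [|_ _ [w ->] [w' ->]|j ji].
  - by exists 0; rewrite raddf0.
  - by exists (w + w'); rewrite rmulDr.
  have [->|/imin ij] := eqVneq (c j) 0.
    by exists 0; rewrite mulr0z raddf0.
  have {}ij : (i < j)%N by rewrite ltn_neqAle ij andbT eq_sym.
  (* The ring may lack a unit, so the cofactor must be a nonempty product; [i < j] supplies its
     first factor. *)
  have [y [t vj]] : exists y t, v j = foldl rmul (v i) (y :: t).
    exists (nth 0 s i), (drop i.+1 (take j s)); rewrite /v.
    rewrite -{1}(cat_take_drop i (take j s)) foldl_cat take_takel ?(ltnW ij) //.
    by rewrite (drop_nth 0) ?nth_take // size_takel // -ltnS.
  by exists (foldl rmul y t *~ c j); rewrite rmulrMz vj /= foldl_rmulA.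
apply: (@no_right_eigenvector (v i) w (- c i)) => //; first by rewrite oppr_eq0.
rewrite mulrNz -vw; apply/eqP; rewrite -addr_eq0 addrC; apply/eqP.
by rewrite -[RHS]sum0 [RHS](bigD1 i).
Qed.

Lemma virtually_nilpotent_of_growth : virtually_nilpotent S.
Proof.
exists setT; split; [exact: ideal_setT|exact: finite_index_setT|].
(* The class in [nilpotent] is a natural number, so one above [d] is chosen. *)
exists (Num.bound `|d|) => x s dk; apply: nilpotent_setT.
apply: le_lt_trans (ler_norm _) (lt_trans (archi_boundP (normr_ge0 d)) _).
by rewrite ltr_nat; move: dk; rewrite natz ltz_nat.
Qed.

End Growth.

Theorem theorem6p8 (R : realType) :
  (forall S : rngType,
     finitely_generated S -> torsion_free S -> polynomial_growth S R ->
     virtually_nilpotent S) /\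
  (forall d : R, 0 < d ->
     exists C : R, forall (S : rngType) (X : set S),
       torsion_free S ->
       finite_set X -> additively_symmetric X -> generated_by X ->
       (forall N : nat, exists n : nat, [/\ (N <= n)%N, (0 < n)%N &
          #|` fset_set (upto X n)|%:R <= n%:R `^ d * #|` fset_set X|%:R]) ->
       (exists I : set S, [/\ ideal I, finite_index I, (additive_index I)%:R <= C &
          nilpotent_of_class_le (4 * (57 * d + 1)) I]) /\
       virtually_nilpotent S).
Proof.
split=> [S _ tfS [X [finX symX genX [d [C growthX]]]]|d d0].
  apply: (@virtually_nilpotent_of_growth R S X d%:R C) => // N.
  (* The polynomial bound is given for positive [n] only, while [N] may be 0. *)
  exists (maxn N 1); split; rewrite ?leq_maxl ?leq_maxr //.
  by rewrite powR_mulrn // mulrC growthX // leq_maxr.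
(* The ideal will be [S] itself, so index bound 1 serves every [d]. *)
exists 1 => S X tfS finX symX genX growthX; split.
  exists setT; rewrite additive_index_setT.
  split=> //; [exact: finite_index_setT|].
  move=> x s dk; apply: (nilpotent_setT tfS finX symX genX growthX).
  by apply: lt_trans dk; lra.
exact: (virtually_nilpotent_of_growth tfS finX symX genX growthX).
Qed.
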